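(* Let $\mathcal X=\{x\in\mathbb R^d: Ax\le b\}$ be a nonempty bounded polytope, $\mathcal C\subseteq\mathbb R^d$ a convex set, and $P_c$ a probability distribution supported on $\mathcal C$. Fix an anchor $x_0\in\mathcal X^\star(\mathcal C)$ independently of the $n\ge 1$ training costs. Let $c_1,\dots,c_n$ be i.i.d. from $P_c$ and let $(U_n,T_n)$ be the output of the sample-based learning algorithm (described in the context) run on $c_1,\dots,c_n$ with anchor $x_0$. Then $$\operatorname{range}(U_n)\subseteq\operatorname{dir}(\mathcal X^\star(\mathcal C)),\qquad |T_n|\le\operatorname{rank}(U_n)\le d^\star,$$ and $\mathsf{Exact}(U_n,x_0,c_i)$ holds for every training sample $i=1,\dots,n$. Moreover, for any $\delta\in(0,1)$, with probability at least $1-\delta$ over the training sample, $$\mathbb P_{c\sim P_c}\!\left[\mathsf{Exact}(U_n,x_0,c)\right]\ \ge\ 1-\frac4n\bigl(6|T_n|+\log(e/\delta)\bigr)\ \ge\ 1-\frac4n\bigl(6d^\star+\log(e/\delta)\bigr),$$ where $c\sim P_c$ is a fresh draw independent of the training sample.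
   Context: For $c\in\mathbb R^d$, $\mathcal X^\star(c):=\operatorname*{arg\,min}_{x\in\mathcal X}c^\top x$ (the set of all minimizers), and $\mathcal X^\star(\mathcal C):=\bigcup_{c\in\mathcal C}\mathcal X^\star(c)$. $\mathcal X^\angle$ is the set of extreme points of $\mathcal X$. For $S\subseteq\mathbb R^d$, $\operatorname{dir}(S):=\operatorname{span}\{x-x':x,x'\in S\}$, and $d^\star:=\dim\operatorname{dir}(\mathcal X^\star(\mathcal C))$. For $x_0\in\mathcal X$ and $U\in\mathbb R^{d\times r}$ with linearly independent columns ($r=0$ allowed, with $\operatorname{range}(U)=\{0\}$): $T_{U,x_0}(z):=x_0+Uz$; $\mathcal Z_{U,x_0}:=\{z\in\mathbb R^r: T_{U,x_0}(z)\in\mathcal X\}$; $F_{U,x_0}(c):=\operatorname*{arg\,min}_{z\in\mathcal Z_{U,x_0}}(U^\top c)^\top z$. $\mathsf{Exact}(U,x_0,c)$ is the statement $\mathcal X^\star(c)=T_{U,x_0}(F_{U,x_0}(c))$. Sample-based learning algorithm. Input: $\mathcal X$, a fixed anchor $x_0\in\mathcal X^\star(\mathcal C)$, a sequence of costs $c_1,\dots,c_n$, and a fixed deterministic (measurable) tie-breaking rule, by which every choice below is a function of the current cost and the current matrix. Initialize $U_0$ as the empty $d\times 0$ matrix and $T_n=\emptyset$. For $i=1,\dots,n$: set $U_i\leftarrow U_{i-1}$; while $\mathcal X^\star(c_i)\not\subseteq x_0+\operatorname{range}(U_i)$, choose $x\in\mathcal X^\star(c_i)\cap\mathcal X^\angle$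 with $x-x_0\notin\operatorname{range}(U_i)$, append $x-x_0$ as a new column of $U_i$, and set $T_n\leftarrow T_n\cup\{i\}$. Output $(U_n,T_n)$. (The set $T_n$ is thus the set of indices of samples triggering at least one append.) *)

(* Defs.v *)
From HB Require Import structures.
From mathcomp Require Import all_boot all_order all_algebra.
From mathcomp Require Import all_classical all_reals all_analysis.

Set Implicit Arguments.
Unset Strict Implicit.
Unset Printing Implicit Defensive.

Import Order.TTheory GRing.Theory Num.Theory.
Import numFieldNormedType.Exports.

Local Open Scope classical_set_scope.
Local Open Scope ring_scope.

Notation borel_mx R m n := (g_sigma_algebraType (@open 'M[R]_(m, n))).
Notation borel_cV R d := (borel_mx R d 1).

Section Span.
Context {K : fieldType} {V : vectType K}.
Implicit Types (S : set V) (W : {vspace V}).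

Definition is_span S W :=
  (forall v, S v -> v \in W) /\
  (forall W', (forall v, S v -> v \in W') -> (W <= W')%VS).

Lemma exists_span S : exists W, is_span S W.
Proof.
have exk : exists k, `[< exists W, (forall v, S v -> v \in W) /\ \dim W = k >].
  exists (\dim {:V}); apply/asboolP; exists fullv.
  by split=> // v _; exact: memvf.
case: (ex_minnP exk) => k /asboolP[W [SW dW]] kmin.
exists W; split=> // W' SW'.
suff /eqP <- : (W :&: W' == W)%VS by exact: capvSr.
rewrite eqEdim capvSl /= dW; apply: kmin; apply/asboolP.
exists (W :&: W')%VS; split=> // v Sv.
by rewrite memv_cap SW ?SW'.
Qed.

(* The library's span takes a finite sequence; S may be infinite here. *)
Definition span_set S : {vspace V} := sval (cid (exists_span S)).

Lemma span_setP S : is_span S (span_set S).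
Proof. by rewrite /span_set; case: cid. Qed.

Definition dir S : {vspace V} := span_set [set x - x' | x in S & x' in S].

End Span.

Section LinearProgram.
Context {R : realType} {d : nat}.
Implicit Types (X C : set 'cV[R]_d) (c x : 'cV[R]_d).

Definition polytope m (A : 'M[R]_(m, d)) (b : 'cV[R]_m) : set 'cV[R]_d :=
  [set x | forall i, (A *m x) i 0 <= b i 0].

Definition dot k (u v : 'cV[R]_k) : R := (u^T *m v) 0 0.

Definition argmin_set T (S : set T) (f : T -> R) : set T :=
  [set x | S x /\ forall y, S y -> f x <= f y].

Definition minimizers X c : set 'cV[R]_d := argmin_set X (dot c).

Definition all_minimizers X C : set 'cV[R]_d := \bigcup_(c in C) minimizers X c.

Definition extreme_points X : set 'cV[R]_d :=
  [set x | X x /\ forall y z t, X y -> X z -> 0 < t < 1 ->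
     x = t *: y + (1 - t) *: z -> y = x /\ z = x].

Definition mx_range r (U : 'M[R]_(d, r)) : set 'cV[R]_d :=
  range (fun z : 'cV[R]_r => U *m z).

Definition reconstruct r (U : 'M[R]_(d, r)) x0 (z : 'cV[R]_r) : 'cV[R]_d :=
  x0 + U *m z.

Definition reduced_feasible X r (U : 'M[R]_(d, r)) x0 : set 'cV[R]_r :=
  [set z | X (reconstruct U x0 z)].

Definition reduced_minimizers X r (U : 'M[R]_(d, r)) x0 c : set 'cV[R]_r :=
  argmin_set (reduced_feasible X U x0) (dot (U^T *m c)).

Definition Exact X r (U : 'M[R]_(d, r)) x0 c : Prop :=
  minimizers X c = reconstruct U x0 @` reduced_minimizers X U x0 c.

End LinearProgram.

Section Algorithm.
Context {R : realType} {d : nat} (X : set 'cV[R]_d) (x0 : 'cV[R]_d).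

Definition uncovered (c : 'cV[R]_d) r (U : 'M[R]_(d, r)) : Prop :=
  ~ (minimizers X c `<=` [set x0 + v | v in mx_range U]).

Definition tie_break_rule := forall r, 'cV[R]_d -> 'M[R]_(d, r) -> 'cV[R]_d.

Definition valid_rule (rule : tie_break_rule) : Prop :=
  forall r c (U : 'M[R]_(d, r)), uncovered c U ->
    [/\ minimizers X c (rule r c U), extreme_points X (rule r c U) &
        ~ mx_range U (rule r c U - x0)].

Definition measurable_rule (rule : tie_break_rule) : Prop :=
  forall r, measurable_fun setT
    ((fun cU => rule r cU.1 cU.2) :
       borel_cV R d * borel_mx R d r -> borel_cV R d).

Variable rule : tie_break_rule.

(* A current matrix, with its number of columns, and the set of indices
   that have triggered an append. *)
Definition state n := ({r : nat & 'M[R]_(d, r)} * {set 'I_n})%type.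

Section Run.
Context {n : nat} (c : 'I_n -> 'cV[R]_d).

Definition loop_body (i : 'I_n) (s : state n) : state n :=
  let U := projT2 s.1 in
  if `[< uncovered (c i) U >]
  then (existT (fun r => 'M[R]_(d, r)) _ (row_mx U (rule (c i) U - x0)),
        i |: s.2)
  else s.

(* The while loop of sample i. Each append raises the rank by one, so at most d
   iterations run and the loop is unrolled d times; loop_body is the identity
   once the guard fails. See process_exit. *)
Definition process (i : 'I_n) (s : state n) : state n := iter d (loop_body i) s.

Definition initial_state : state n :=
  (existT (fun r => 'M[R]_(d, r)) 0%N 0, finset.set0).

Definition learn : state n :=
  foldl (fun s i => process i s) initial_state (enum 'I_n).

Definition learned_mx : 'M[R]_(d, projT1 learn.1) := projT2 learn.1.

Definition learned_idx : {set 'I_n} := learn.2.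

Lemma mxrank_append r (U : 'M[R]_(d, r)) (v : 'cV[R]_d) :
  ~ mx_range U v -> (\rank U < \rank (row_mx U v))%N.
Proof.
move=> Uv; rewrite -(mxrank_tr U) -(mxrank_tr (row_mx U v)) tr_row_mx.
have sUW : (U^T <= col_mx U^T v^T)%MS by rewrite -addsmxE addsmxSl.
rewrite ltn_neqAle mxrankS // andbT; apply/negP => /eqP eqr; apply: Uv.
have /submxP[D Dv] : (v^T <= U^T)%MS.
  have := mxrank_leqif_sup sUW => -[_]; rewrite eqr eqxx => /esym.
  by apply: submx_trans; rewrite -addsmxE addsmxSr.
by exists D^T => //; rewrite -[v]trmxK Dv trmx_mul trmxK.
Qed.

Lemma process_exit (i : 'I_n) (s : state n) :
  valid_rule rule -> ~ uncovered (c i) (projT2 (process i s).1).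
Proof.
move=> vr; rewrite /process.
have H k : ~ uncovered (c i) (projT2 (iter k (loop_body i) s).1) \/
    (k <= \rank (projT2 (iter k (loop_body i) s).1))%N.
  elim: k => [|k IHk]; first by right.
  rewrite iterS; set t := iter k _ s in IHk *.
  rewrite /loop_body; case: asboolP => [unc|]; last by left.
  right; case: IHk => [//|/leq_ltn_trans]; apply.
  by apply: mxrank_append; case: (vr _ _ _ unc).
case: (H d) => // rk; apply; move=> x _.
set U := projT2 _ in rk *; exists (x - x0); last by rewrite addrC subrK.
have : row_full U^T by rewrite /row_full mxrank_tr eqn_leq rk rank_leq_row.
move=> fullU; have /submxP[D DE] : ((x - x0)^T <= U^T)%MS by exact: submx_full.
by exists D^T => //; rewrite -[RHS]trmxK DE trmx_mul trmxK.
Qed.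

End Run.
End Algorithm.

Section Independence.
Context {R : realType} {dO dT : measure_display} {Omega : measurableType dO}.
Context {T : measurableType dT} (P : probability Omega R).

Definition mutually_independent n (X : 'I_n -> {RV P >-> T}) : Prop :=
  forall (J : {set 'I_n}) (B : 'I_n -> set T),
    (forall i, measurable (B i)) ->
    P (\bigcap_(i in [set` J]) (X i @^-1` B i)) =
    (\prod_(i in J) P (X i @^-1` B i))%E.

Definition iid_from n (X : 'I_n -> {RV P >-> T}) (Q : probability T R) : Prop :=
  mutually_independent X /\
  forall i (B : set T), measurable B -> distribution P (X i) B = Q B.

End Independence.

(* Main.v *)
Require Import Defs.
From mathcomp Require Import all_boot all_order all_algebra.
From mathcomp Require Import all_classical all_reals all_analysis.
From mathcomp Require Import ring lra.

Set Implicit Arguments.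
Unset Strict Implicit.
Unset Printing Implicit Defensive.

Import Order.TTheory GRing.Theory Num.Theory.
Import numFieldNormedType.Exports.

Local Open Scope classical_set_scope.
Local Open Scope ring_scope.

(** The learner is conservative: it enlarges its matrix only at a cost whose
minimizers are not yet contained in [x0 + range U]. As the minimizers of every
cost form a nonempty set, [Exact X U x0 c] says exactly that [c] is covered in
this sense ([Exact_covered]), so the statements about the training sample are
invariants of the loop: every appended column lies in [dir], each triggering
index raises the rank, and a processed cost stays covered since ranges grow.

For the probabilistic bound let [p_i] be the probability, given the first
[i - 1] samples, that sample [i] triggers an append. Ranges only grow, so the
[p_i] decrease and the final risk, i.e. the probability that a fresh cost is not
covered, is at most each of them. Because
[exp (p / 2) * (1 - p + p / e) <= 1], the process
[exp (\sum_(j <= i) p_j / 2 - |T_i|)] is a supermartingale started at 1, and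
Markov's inequality gives, outside an event of probability [delta],
[n * risk / 2 < |T_n| + log (1 / delta)]. This is stronger than
[n * risk <= 4 * (6 * |T_n| + log (e / delta))].

The supermartingale argument reduces to finite sums. A
polytope has finitely many extreme points ([finite_extreme_points]) and the rule
picks its columns among them, so the state of the algorithm is a random variable
with finitely many values. The evolution of the state then splits the sample
space into finitely many cylinders [{X_i \in B_i for i in I}], on which
independence is just the product formula, and the bound follows by induction on
the number of samples still to be read ([cylinder_overshoot]). *)

(** * Maps with finitely many values *)

Section FinitelyValued.
Context {dT : measure_display} {T : measurableType dT}.

(** The range of [f] carries no sigma-algebra: measurability of the fibers is
enough to make every preimage measurable. *)
Definition finitely_valued {S : Type} (f : T -> S) : Prop :=
  finite_set (range f) /\ forall s, measurable (f @^-1` [set s]).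

Lemma finitely_valued_cst {S : Type} (s : S) : finitely_valued (fun=> s).
Proof.
split; first by apply: (sub_finite_set _ (finite_set1 s)) => _ [x _ <-].
by move=> s'; rewrite preimage_cst; case: ifP => _.
Qed.

(** Closure under composition of state transitions: the map applied at the
second stage may depend on both the intermediate value and the point. *)
Lemma finitely_valued_bind {S S' : Type} (f : T -> S) (g : S -> T -> S') :
  finitely_valued f -> (forall s, finitely_valued (g s)) ->
  finitely_valued (fun x => g (f x) x).
Proof.
move=> [ffin fm] gfv; split.
  have := bigcup_finite ffin (fun s _ => (gfv s).1).
  by apply: sub_finite_set => _ [x _ <-]; exists (f x) => //; exists x.
move=> s'.
have -> : (fun x => g (f x) x) @^-1` [set s'] =
    \bigcup_(s in range f) (f @^-1` [set s] `&` g s @^-1` [set s']).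
  apply/seteqP; split=> [x /= gx|x [s _ [/= -> //]]].
  by exists (f x) => //; exists x.
apply: fin_bigcup_measurable => // s _.
by apply: measurableI => //; exact: (gfv s).2.
Qed.

Lemma finitely_valued_preimage {S : Type} (f : T -> S) (A : set S) :
  finitely_valued f -> measurable (f @^-1` A).
Proof.
move=> [ffin fm].
have -> : f @^-1` A = \bigcup_(s in range f `&` A) f @^-1` [set s].
  apply/seteqP; split=> [x /= Ax|x [s [_ As] /= -> //]].
  by exists (f x) => //; split=> //; exists x.
by apply: fin_bigcup_measurable => //; exact: finite_setIl.
Qed.

(** Only the values of [r] on [A] have to be finitely many: a tie-breaking rule
is unconstrained at the costs on which it is not consulted. *)
Lemma finitely_valued_branch {V S : Type} (A : set T) (E : set V) (r : T -> V)
    (h : V -> S) (s : S) :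
  measurable A -> finite_set E -> A `<=` r @^-1` E ->
  (forall v, E v -> measurable (r @^-1` [set v])) ->
  finitely_valued (fun x => if `[< A x >] then h (r x) else s).
Proof.
move=> mA Efin AE mr; split.
  apply: (@sub_finite_set _ _ ([set s] `|` h @` E)).
    move=> _ [x _ <-]; case: asboolP => [/AE Ex|_]; last by left.
    by right; exists (r x).
  by rewrite finite_setU; split => //; exact: finite_image.
move=> s'.
have -> : (fun x => if `[< A x >] then h (r x) else s) @^-1` [set s'] =
    (\bigcup_(v in E `&` h @^-1` [set s']) (A `&` r @^-1` [set v])) `|`
    (if `[< s = s' >] then ~` A else set0).
  apply/seteqP; split=> x /=.
    case: asboolP => [Ax hx|nAx ->]; last by right; rewrite asboolT.
    by left; exists (r x) => //; split=> //; exact: AE.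
  case=> [[v [_ hv] [Ax /= rx]]|]; first by rewrite asboolT // rx.
  by case: (asboolP (s = s')) => // -> nAx; rewrite asboolF.
apply: measurableU; last by case: ifP => // _; exact: measurableC.
apply: fin_bigcup_measurable; first exact: finite_setIl.
by move=> v [Ev _]; apply: measurableI => //; exact: mr.
Qed.

End FinitelyValued.

Lemma finitely_valued_comp {dT dO : measure_display} {T : measurableType dT}
    {Omega : measurableType dO} {S : Type} (f : T -> S) (X : Omega -> T) :
  measurable_fun setT X -> finitely_valued f -> finitely_valued (f \o X).
Proof.
move=> mX [ffin fm]; split.
  by apply: sub_finite_set ffin => _ [w _ <-]; exists (X w).
by move=> s; rewrite comp_preimage -[X in measurable X]setTI; exact: mX.
Qed.

(** * Cylinders of an i.i.d. family *)

Section Cylinder.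
Context {R : realType} {dO dT : measure_display} {Omega : measurableType dO}.
Context {T : measurableType dT} {P : probability Omega R} {Q : probability T R}.
Context {n : nat} {X : 'I_n -> {RV P >-> T}}.
Implicit Types (J : {set 'I_n}) (B : 'I_n -> set T) (i : 'I_n) (A : set T).

Definition cylinder (J : {set 'I_n}) (B : 'I_n -> set T) : set Omega :=
  \bigcap_(i in [set` J]) (X i @^-1` B i).

Lemma measurable_RV_preimage i (A : set T) :
  measurable A -> measurable (X i @^-1` A).
Proof.
by move=> mA; rewrite -[X in measurable X]setTI; exact: measurable_funP.
Qed.

Lemma measurable_cylinder J B : (forall i, measurable (B i)) ->
  measurable (cylinder J B).
Proof.
move=> mB; apply: fin_bigcap_measurable => // i _.
exact: measurable_RV_preimage.
Qed.

Definition constrain (B : 'I_n -> set T) i A j := if j == i then A else B j.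

Lemma cylinder_constrain J B i A : i \notin J ->
  cylinder (i |: J)%SET (constrain B i A) = cylinder J B `&` X i @^-1` A.
Proof.
move=> iJ; apply/seteqP; split=> [w Ew|w [Ew Aw] j /=].
  split=> [j /= jJ|].
    have := Ew j; rewrite /= /constrain !inE jJ orbT => /(_ isT).
    by case: eqP => // ji; rewrite -ji jJ in iJ.
  by have := Ew i; rewrite /= /constrain !inE eqxx => /(_ isT).
rewrite /constrain !inE; case: eqP => [-> _ //|_ /= jJ]; exact: Ew.
Qed.

(** A cylinder over [J] is independent of a sample outside [J]; this is the only
use of independence in the risk bound. *)
Lemma iid_cylinder_constrain J B i A : iid_from X Q -> i \notin J ->
  (forall j, measurable (B j)) -> measurable A ->
  (P (cylinder J B `&` X i @^-1` A) = P (cylinder J B) * Q A)%E.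
Proof.
move=> [indep same] iJ mB mA.
rewrite -cylinder_constrain // !indep //; last first.
  by move=> j; rewrite /constrain; case: ifP.
rewrite big_setU1 //= muleC; congr (_ * _)%E; last first.
  by rewrite /constrain eqxx -(same i).
apply: eq_bigr => j jJ; rewrite /constrain; case: eqP => // ji.
by rewrite -ji jJ in iJ.
Qed.

Lemma null_bigcup_RV N : measurable N -> (forall i, P (X i @^-1` N) = 0%E) ->
  P (\bigcup_i X i @^-1` N) = 0%E.
Proof.
move=> mN PN; have mXN i := measurable_RV_preimage i mN.
apply/eqP; rewrite eq_le measure_ge0 andbT.
have : (P (\bigcup_i X i @^-1` N) <= \sum_(i \in setT) P (X i @^-1` N))%E.
  apply: content_sub_fsum => //; first exact: finite_finset.
  exact: fin_bigcup_measurable.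
by rewrite fsbig1.
Qed.

End Cylinder.
Arguments cylinder {R dO dT Omega T P n} X J B.

(** * Risk of a conservative online learner *)

(** The one-step supermartingale inequality: a sample triggers a change with
probability [p], which costs a factor [1 / e], and [p / 2] is the compensation.
It holds since [1 / e <= 1 / 2]. *)
Lemma mistake_mgf_le1 {R : realType} (p : R) : 0 <= p ->
  expR (p / 2) * (1 - p + p * expR (-1)) <= 1.
Proof.
move=> p0; have e1 : expR (-1) <= 2^-1 :> R.
  rewrite expRN lef_pV2 ?posrE ?expR_gt0 ?ltr0n //.
  by have := expR_ge1Dx (1 : R); rewrite -natr1.
have le_exp : 1 - p + p * expR (-1) <= expR (- (p / 2)).
  apply: le_trans (expR_ge1Dx _); have := ler_wpM2l p0 e1; lra.
apply: le_trans (ler_wpM2l (expR_ge0 _) le_exp) _.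
by rewrite -expRD subrr expR0.
Qed.

(** An abstract learner reading one sample at a time. The points of [mistake s]
are those at which the state [s] changes, [tags s] records the indices of the
past changes, and the risk of [s] is the probability of [mistake s]. *)
Section ConservativeLearner.
Context {R : realType} {dO dT : measure_display} {Omega : measurableType dO}.
Context {T : measurableType dT} (P : probability Omega R) (Q : probability T R).
Context {n : nat} (X : 'I_n -> {RV P >-> T}).
Context {S : choiceType} (step : 'I_n -> T -> S -> S).
Context (mistake : S -> set T) (tags : S -> {set 'I_n}).

Definition run w (s : S) (J : seq 'I_n) : S :=
  foldl (fun s i => step i (X i w) s) s J.

Definition risk (s : S) : R := fine (Q (mistake s)).

(** On this event the exponent of the supermartingale ends at [L] or above: the
final risk bounds below the risk at each of the [n] steps. *)
Definition overshoot (L : R) s J : set Omega :=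
  [set w | L <= n%:R * (risk (run w s J) / 2) - #|tags (run w s J)|%:R].

Hypothesis iidX : iid_from X Q.
Hypothesis step_fv : forall i s, finitely_valued (fun x => step i x s).
Hypothesis measurable_mistake : forall s, measurable (mistake s).
Hypothesis conservative : forall i x s, ~ mistake s x -> step i x s = s.
Hypothesis tagged : forall i x s,
  mistake s x -> tags (step i x s) = (i |: tags s)%SET.
Hypothesis shrinking : forall i x s, mistake (step i x s) `<=` mistake s.

Lemma run_finitely_valued s J : finitely_valued (fun w => run w s J).
Proof.
elim: J s => [|i J IH] s; first exact: finitely_valued_cst.
apply: (@finitely_valued_bind _ _ _ _ (fun w => step i (X i w) s)
  (fun s' w => run w s' J)) => //.
exact: (finitely_valued_comp (f := fun x => step i x s)).
Qed.

Lemma measurable_overshoot L s J : measurable (overshoot L s J).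
Proof.
exact: (finitely_valued_preimage
  [set s' | L <= n%:R * (risk s' / 2) - #|tags s'|%:R]
  (run_finitely_valued s J)).
Qed.

Let riskE s : (risk s)%:E = Q (mistake s).
Proof. by rewrite fineK // fin_num_measure. Qed.

Lemma risk_ge0 s : 0 <= risk s.
Proof. by rewrite fine_ge0. Qed.

Lemma risk_step i x s : risk (step i x s) <= risk s.
Proof.
by rewrite -lee_fin !riskE le_measure ?inE //; exact: shrinking.
Qed.

(** The Markov bound on the probability of an overshoot, seen from the state [s]
with [k] samples still to be read. The [n - k] samples already read are all
charged the current risk, which is a lower bound on the risk they were read at;
so this never exceeds the supermartingale of the true history. *)
Definition potential (L : R) s k : R :=
  expR (risk s / 2 * (n - k)%:R - #|tags s|%:R - L).

Lemma potential_step L i x s k : (k < n)%N -> i \notin tags s -> mistake s x ->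
  potential L (step i x s) k <= potential L s k * expR (-1).
Proof.
move=> kn is_ sx; rewrite -expRD ler_expR tagged // cardsU1 is_ natrD /=.
have := ler_wpM2r (ler0n R (n - k)) (risk_step i x s); lra.
Qed.

(** Induction on the unread samples [J]. The event [cylinder X I B] describes
what is known of the samples read so far. Reading sample [i] either leaves [s]
unchanged, or changes it, in finitely many ways; each of these outcomes again
refines the cylinder by a condition on sample [i] alone, so the induction
hypothesis applies to each. The two cases have conditional probabilities
[1 - risk s] and [risk s], and [mistake_mgf_le1] recombines them. *)
Lemma cylinder_overshoot L J s (I : {set 'I_n}) B :
  uniq J -> (forall i, i \in J -> (i \notin I) && (i \notin tags s)) ->
  (forall i, measurable (B i)) ->
  (P (cylinder X I B `&` overshoot L s J) <=
   P (cylinder X I B) * (potential L s (size J))%:E)%E.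
Proof.
elim: J s I B => [|i J IH] s I B.
  move=> _ _ mB; have mE := @measurable_cylinder _ _ _ _ _ P _ X I B mB.
  have [bad|good] :=
    pselect (L <= n%:R * (risk s / 2) - #|tags s|%:R); last first.
    rewrite (_ : overshoot _ _ _ = set0); last by apply/seteqP; split.
    by rewrite setI0 measure0 mule_ge0 // lee_fin expR_ge0.
  apply: (@le_trans _ _ (P (cylinder X I B))).
    rewrite le_measure ?inE //; apply: measurableI => //.
    exact: measurable_overshoot.
  rewrite -[leLHS]mule1 lee_wpmul2l // lee_fin.
  by rewrite -expR0 ler_expR /= subn0; lra.
move=> /= /andP[iJ uJ] fresh mB.
have /andP[iI itag] := fresh i (mem_head _ _).
have freshJ j : j \in J -> [/\ j \notin (i |: I)%SET, j \notin tags s & j != i].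
  move=> jJ; have := fresh j; rewrite inE jJ orbT => /(_ isT)/andP[jI jtag].
  have ji : j != i by apply: contraNneq iJ => <-.
  by rewrite !inE negb_or ji jI.
have kn : (size J < n)%N.
  have /card_uniqP Jcard : uniq (i :: J) by rewrite /= iJ.
  by have := max_card (mem (i :: J)); rewrite Jcard card_ord.
set E := cylinder X I B; set M := X i @^-1` mistake s.
have mE : measurable E by exact: measurable_cylinder.
have mM : measurable M by exact: measurable_RV_preimage.
set w0 := potential L s (size J).
have w0_ge0 : 0 <= w0 by exact: expR_ge0.
have w1_ge0 : 0 <= w0 * expR (-1) by rewrite mulr_ge0 // expR_ge0.
have quiet : (P (E `&` ~` M `&` overshoot L s (i :: J)) <=
    P (E `&` ~` M) * w0%:E)%E.
  have mnM : measurable (~` mistake s) by exact: measurableC.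
  rewrite -(@cylinder_constrain _ _ _ _ _ P _ X I B i (~` mistake s)) //.
  have := IH s (i |: I)%SET (constrain B i (~` mistake s)) uJ.
  rewrite cylinder_constrain // -/E (_ : X i @^-1` (~` _) = ~` M) // => IHs.
  apply: le_trans (IHs _ _); last by move=> j; rewrite /constrain; case: ifP.
    have mEM : measurable (E `&` ~` M).
      by apply: measurableI => //; exact: measurableC.
    rewrite le_measure ?inE //.
    - by apply: measurableI => //; exact: measurable_overshoot.
    - by apply: measurableI => //; exact: measurable_overshoot.
    by move=> w [[Ew nMw] /=]; rewrite /overshoot /= conservative.
  by move=> j /freshJ[-> ->].
(* Only the samples that change the state need be told apart by the new state
   [s'], and for all of them the potential drops by the factor [1 / e]. *)
have loud : (P (E `&` M `&` overshoot L s (i :: J)) <=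
    P (E `&` M) * (w0 * expR (-1))%:E)%E.
  pose F s' := mistake s `&` [set x | step i x s = s'].
  have mF s' : measurable (F s').
    by apply: measurableI => //; exact: (step_fv i s).2.
  have := (step_fv i s).1; set D := (X in finite_set X) => Ffin.
  have piece s' : D s' ->
      (P (E `&` X i @^-1` F s' `&` overshoot L s' J) <=
       P (E `&` X i @^-1` F s') * (w0 * expR (-1))%:E)%E.
    move=> _; have [[x [sx xs']]|none] := pselect (F s' !=set0); last first.
      have -> : F s' = set0 by apply/eqP/negP => /negP/set0P.
      by rewrite preimage_set0 setI0 set0I measure0 mul0e.
    rewrite -(@cylinder_constrain _ _ _ _ _ P _ X I B i (F s')) //.
    apply: le_trans (IH _ _ _ uJ _ _) _.
    - move=> j /freshJ[-> jtag ji]; rewrite -xs' tagged //.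
      by rewrite !inE negb_or ji jtag.
    - by move=> j; rewrite /constrain; case: ifP.
    apply: lee_wpmul2l => //; rewrite lee_fin -xs'.
    exact: potential_step.
  have pieces : (P (E `&` M `&` overshoot L s (i :: J)) <=
      \sum_(s' \in D) P (E `&` X i @^-1` F s' `&` overshoot L s' J))%E.
    apply: content_sub_fsum => //.
    - move=> s' _; apply: measurableI; last exact: measurable_overshoot.
      by apply: measurableI => //; exact: measurable_RV_preimage.
    - by apply: measurableI; [exact: measurableI|exact: measurable_overshoot].
    move=> w [[Ew Mw] ow]; exists (step i (X i w) s); first by exists (X i w).
    by split.
  apply: le_trans pieces _; apply: le_trans (lee_fsum _ piece) _ => //.
  rewrite -ge0_mule_fsuml // -measure_fin_bigcup //.
  - apply: lee_wpmul2r => //; rewrite le_measure ?inE //.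
    + apply: fin_bigcup_measurable => // s' _; apply: measurableI => //.
      exact: measurable_RV_preimage.
    + exact: measurableI.
    by move=> w [s' _ [Ew [Mw _]]].
  - by move=> s1 s2 _ _ [w [[_ [_ /= <-]] [_ [_ /= <-]]]].
  by move=> s' _; apply: measurableI => //; exact: measurable_RV_preimage.
set b := overshoot L s (i :: J).
have mb : measurable b by exact: measurable_overshoot.
have -> : E `&` b = (E `&` ~` M `&` b) `|` (E `&` M `&` b).
  by rewrite -setIUl -setIUr setUC setUv setIT.
apply: le_trans (measureU2 _ _ _) _.
- by do 2 ?apply: measurableI => //; exact: measurableC.
- by do 2 ?apply: measurableI.
apply: le_trans (leeD quiet loud) _.
rewrite (_ : ~` M = X i @^-1` (~` mistake s)) // /M.
rewrite !(iid_cylinder_constrain iidX) //; last exact: measurableC.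
rewrite probability_setC // -/E -riskE -(fineK (fin_num_measure P E mE)).
rewrite -EFinB -!EFinM -EFinD lee_fin.
have e0 : 0 <= fine (P E) by exact: fine_ge0.
rewrite -mulrA -mulrA -mulrDr ler_wpM2l //.
have -> : w0 = potential L s (size J).+1 * expR (risk s / 2).
  rewrite -expRD; congr expR.
  by rewrite -(subnSK kn) -natr1; lra.
set W := potential _ _ _.
have := ler_wpM2l (expR_ge0 _ : 0 <= W) (mistake_mgf_le1 (risk_ge0 s)); lra.
Qed.

(** With no sample read and no index recorded, the potential is
[expR (- L)]. *)
Lemma overshoot_probability L s : tags s = finset.set0 ->
  (P (overshoot L s (enum 'I_n)) <= (expR (- L))%:E)%E.
Proof.
move=> s0; have := @cylinder_overshoot L (enum 'I_n) s finset.set0 (fun=> setT).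
have -> : cylinder X finset.set0 (fun=> setT) = setT.
  by apply/seteqP; split=> // w _ i; rewrite /= inE.
rewrite setTI probability_setT mul1e /potential size_enum_ord subnn s0 cards0.
rewrite mulr0 subrr sub0r; apply=> //; first exact: enum_uniq.
by move=> i; rewrite !inE.
Qed.

End ConservativeLearner.

(** * Vertices and minimizers of a polytope *)

Section MatrixTopology.
Context {R : realType}.

Lemma continuous_lin_form d (a : 'I_d -> R) :
  continuous (fun x : 'cV[R]_d => \sum_(j < d) a j * x j 0).
Proof.
apply: continuous_big => [|j _]; first exact: add_continuous.
move=> x; apply: continuousM; first exact: cst_continuous.
exact: coord_continuous.
Qed.

Lemma dotE k (u v : 'cV[R]_k) : dot u v = \sum_(j < k) u j 0 * v j 0.
Proof. by rewrite /dot mxE; apply: eq_bigr => j _; rewrite mxE. Qed.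

Lemma dotC k (u v : 'cV[R]_k) : dot u v = dot v u.
Proof. by rewrite !dotE; apply: eq_bigr => j _; rewrite mulrC. Qed.

Lemma dotDr k (u v w : 'cV[R]_k) : dot u (v + w) = dot u v + dot u w.
Proof. by rewrite /dot mulmxDr mxE. Qed.

Lemma dot_mulmx d r (c : 'cV[R]_d) (U : 'M[R]_(d, r)) z :
  dot (U^T *m c) z = dot c (U *m z).
Proof. by rewrite /dot trmx_mul trmxK mulmxA. Qed.

Lemma continuous_dot d (c : 'cV[R]_d) : continuous (dot c).
Proof.
rewrite (_ : dot c = fun x => \sum_(j < d) c j 0 * x j 0).
  exact: continuous_lin_form.
by apply/funext => x; rewrite dotE.
Qed.

Lemma norm_trmx_le m n (u : 'M[R]_(m, n)) : `|u^T| <= `|u|.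
Proof.
rewrite [leLHS]/Num.norm /= mx_normrE.
apply/bigmax_leP; split=> //= -[i j] _ /=.
rewrite mxE [leRHS]/Num.norm /= mx_normrE; apply/bigmax_geP; right.
by exists (j, i).
Qed.

Lemma trmx_continuous m n : continuous (@trmx R m n).
Proof.
move=> u s /nbhs_ballP[e e0 es]; apply/nbhs_ballP; exists e => //= v uv.
apply: es; move: uv; rewrite -!ball_normE /= => uv.
by rewrite -linearB /=; apply: le_lt_trans uv; exact: norm_trmx_le.
Qed.

(** Transposition reduces this to row vectors, whose bounded closed sets are
compact. *)
Lemma cV_EVT_min d (X : set 'cV[R]_d) (f : 'cV[R]_d -> R) :
  X !=set0 -> bounded_set X -> closed X -> continuous f ->
  exists2 x, X x & forall y, X y -> f x <= f y.
Proof.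
move=> [x Xx] bX cX cf; pose K := (@trmx R 1 d) @^-1` X.
have cK : compact K.
  apply: bounded_closed_compact; last first.
    exact: (proj1 (continuous_closedP _) (@trmx_continuous 1 d)).
  case: bX => M [Mreal XM]; exists M; split=> // N MN u /(XM N MN).
  apply: le_trans.
  by rewrite -[in leLHS](trmxK u) norm_trmx_le.
have K0 : K !=set0 by exists x^T; rewrite /K /= trmxK.
have cfT : {within K, continuous (f \o (@trmx R 1 d))}.
  apply: continuous_subspaceT => u.
  by apply: continuous_comp; [exact: trmx_continuous|exact: cf].
have [u uK umin] := EVT_min_rV K0 cK cfT.
exists u^T; first by rewrite inE in uK.
by move=> y Xy; have := umin y^T; rewrite /= trmxK inE /K /= trmxK => /(_ Xy).
Qed.

End MatrixTopology.

Section Polytope.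
Context {R : realType} {d m : nat} (A : 'M[R]_(m, d)) (b : 'cV[R]_m).

Lemma closed_polytope : closed (polytope A b).
Proof.
rewrite (_ : polytope A b =
    \bigcap_i (fun x => \sum_(j < d) A i j * x j 0) @^-1` [set y | y <= b i 0]).
  apply: closed_bigI => i _.
  apply: (proj1 (continuous_closedP _) (@continuous_lin_form R d (A i))).
  exact: closed_le.
apply/seteqP; split=> x Px i; first by move=> _; have := Px i; rewrite mxE.
by have := Px i I; rewrite mxE.
Qed.

Lemma minimizers_nonempty c :
  polytope A b !=set0 -> bounded_set (polytope A b) ->
  minimizers (polytope A b) c !=set0.
Proof.
move=> X0 bX; have [x Xx xmin] :=
  cV_EVT_min X0 bX closed_polytope (@continuous_dot R d c).
by exists x.
Qed.

Definition active (x : 'cV[R]_d) : {set 'I_m} :=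
  [set i | (A *m x) i 0 == b i 0]%SET.

(** An extreme point is determined by its active constraints: if every
constraint tight at [x] is tight at [y], the segment from [y] to [x] can be
prolonged a little beyond [x] inside the polytope. *)
Lemma extreme_point_active x y :
  extreme_points (polytope A b) x -> polytope A b y ->
  active x \subset active y -> x = y.
Proof.
move=> [Xx xext] Xy xy.
pose slack i := b i 0 - (A *m x) i 0.
pose u i := (A *m x) i 0 - (A *m y) i 0.
(* Prolonging by [e] uses up at most the slack of each constraint. The terms of
   the tight constraints are divisions by zero and vanish. *)
pose e : R := (1 + \sum_i `|u i| / slack i)^-1.
have slack_ge0 i : 0 <= slack i by rewrite subr_ge0; exact: Xx.
have term_ge0 i : 0 <= `|u i| / slack i by rewrite divr_ge0.
have sum_ge0 : 0 <= \sum_i `|u i| / slack i by exact: sumr_ge0.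
have e0 : 0 < e by rewrite invr_gt0; lra.
have Xz : polytope A b (x + e *: (x - y)).
  move=> i; have -> : (A *m (x + e *: (x - y))) i 0 = (A *m x) i 0 + e * u i.
    rewrite mulmxDr -scalemxAr mulmxBr mxE; congr (_ + _).
    by rewrite mxE; congr (_ * _); rewrite mxE; congr (_ + _); rewrite mxE.
  suff : e * u i <= slack i by rewrite /slack; lra.
  have [slack0|slackN0] := eqVneq (slack i) 0.
    have xi : (A *m x) i 0 = b i 0 by move: slack0; rewrite /slack; lra.
    have : i \in active y by apply: (fintype.subsetP xy); rewrite inE xi.
    by rewrite inE => /eqP yi; rewrite slack0 /u xi yi subrr mulr0.
  have slack_gt0 : 0 < slack i by rewrite lt_def slackN0 slack_ge0.
  apply: le_trans (ler_wpM2l (ltW e0) (ler_norm (u i))) _.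
  rewrite -[leRHS]mul1r -ler_pdivrMr // -mulrA -ler_pdivlMl // mulr1.
  rewrite /e invrK (bigD1 i) //=.
  have := @sumr_ge0 R _ (index_enum _) (fun j => j != i) _
    (fun j _ => term_ge0 j).
  lra.
have e1 : 0 < 1 + e by lra.
have t01 : 0 < e / (1 + e) < 1.
  by rewrite divr_gt0 //= ltr_pdivrMr //; lra.
have xE : x = e / (1 + e) *: y + (1 - e / (1 + e)) *: (x + e *: (x - y)).
  by apply/colP => i; rewrite !mxE; field; rewrite gt_eqF.
by have [-> _] := xext _ _ _ Xy Xz t01 xE.
Qed.

Lemma finite_extreme_points : finite_set (extreme_points (polytope A b)).
Proof.
pose vertex (I : {set 'I_m}) :=
  get [set x | extreme_points (polytope A b) x /\ active x = I].
apply: (@sub_finite_set _ _ (range vertex)); last exact: finite_image.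
move=> x xext; exists (active x) => //.
have [yext yx] :
    [set y | extreme_points (polytope A b) y /\ active y = active x]
    (vertex (active x)) by apply: getPex; exists x.
by apply: extreme_point_active => //; [case: xext|rewrite yx].
Qed.

End Polytope.

(** * Costs covered by a matrix *)

Section Borel.
Context {R : realType} {d : nat}.

Lemma closed_measurable_mx k l (F : set 'M[R]_(k, l)) :
  closed F -> measurable (F : set (borel_mx R k l)).
Proof.
move=> cF; rewrite -[F]setCK; apply: measurableC.
by apply: sub_sigma_algebra; exact: closed_openC.
Qed.

Lemma measurable_optimal_costs (X : set 'cV[R]_d) (v : 'cV[R]_d) :
  measurable ([set c | minimizers X c v] : set (borel_cV R d)).
Proof.
apply: closed_measurable_mx; have [Xv|nXv] := pselect (X v); last first.
  rewrite (_ : [set _ | _] = set0); first exact: closed0.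
  by apply/seteqP; split=> // c [].
rewrite (_ : [set _ | _] = \bigcap_(y in X) dot (v - y) @^-1` [set t | t <= 0]).
  apply: closed_bigI => y _.
  apply: (proj1 (continuous_closedP _) (@continuous_dot R d (v - y))).
  exact: closed_le.
have dotB c y : (dot (v - y) c <= 0) = (dot c v <= dot c y).
  by rewrite dotC /dot mulmxBr !mxE subr_le0.
apply/seteqP; split=> [c [_ cv] y Xy|c cv]; first by rewrite /= dotB cv.
by split=> // y /cv; rewrite /= dotB.
Qed.

End Borel.

Section Covering.
Context {R : realType} {d : nat} (X : set 'cV[R]_d) (x0 : 'cV[R]_d).

(** On [x0 + range U] the reduced objective and the original one differ by the
constant [dot c x0]. So as soon as one minimizer lies there, the reduced program
has the same optimal value and recovers the minimizers lying there. *)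
Lemma Exact_covered r (U : 'M[R]_(d, r)) c :
  minimizers X c !=set0 -> Exact X U x0 c <-> ~ uncovered X x0 c U.
Proof.
move=> [xs xsmin]; split=> [UE|/contrapT cov].
  apply; move=> x; rewrite UE => -[z _ <-].
  by exists (U *m z) => //; exists z.
have redE z : dot (U^T *m c) z = dot c (reconstruct U x0 z) - dot c x0.
  by rewrite dot_mulmx /reconstruct dotDr; ring.
have [_ [zs _ <-] xsE] := cov _ xsmin.
apply/seteqP; split=> [x xmin|_ [z [Xz zmin] <-]].
  have [_ [z _ <-] xE] := cov _ xmin; case: xmin => Xx xmin.
  exists z => //; split=> [|z' Xz'].
    by rewrite /reduced_feasible /= /reconstruct xE.
  by rewrite !redE lerD2r {1}/reconstruct xE xmin.
split=> // y Xy; have [Xxs xsle] := xsmin.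
apply: le_trans (xsle _ Xy).
have zsE : reconstruct U x0 zs = xs by [].
have := zmin zs; rewrite !redE lerD2r zsE; apply.
by rewrite /reduced_feasible /= zsE.
Qed.

Lemma uncovered_anti c r r' (U : 'M[R]_(d, r)) (U' : 'M[R]_(d, r')) :
  mx_range U `<=` mx_range U' -> uncovered X x0 c U' -> uncovered X x0 c U.
Proof.
move=> UU' unc cov; apply: unc => x /cov[v Uv <-].
by exists v => //; exact: UU'.
Qed.

Context {rule : @tie_break_rule R d} (vrule : valid_rule X x0 rule).

(** The rule witnesses any failure of covering by an optimal extreme point, so
it is enough to look at the extreme points; there being finitely many of them,
the set of uncovered costs is measurable. *)
Lemma uncoveredP c r (U : 'M[R]_(d, r)) :
  uncovered X x0 c U <-> exists v,
    [/\ extreme_points X v, minimizers X c v & ~ mx_range U (v - x0)].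
Proof.
split=> [/vrule[]|[v [_ vmin nUv]] cov]; first by exists (rule c U).
by have [u Uu ux] := cov _ vmin; apply: nUv; rewrite -ux addrC addKr.
Qed.

Hypothesis finX : finite_set (extreme_points X).

Lemma measurable_uncovered r (U : 'M[R]_(d, r)) :
  measurable ([set c | uncovered X x0 c U] : set (borel_cV R d)).
Proof.
rewrite (_ : [set _ | _] =
    \bigcup_(v in extreme_points X `&` [set v | ~ mx_range U (v - x0)])
      [set c | minimizers X c v]).
  apply: fin_bigcup_measurable; first exact: finite_setIl.
  by move=> v _; exact: measurable_optimal_costs.
apply/seteqP; split=> [c /uncoveredP[v [? ? ?]]|c [v [? ?] ?]].
  by exists v.
by apply/uncoveredP; exists v.
Qed.

Hypothesis mrule : measurable_rule rule.

Lemma measurable_rule_fiber r (U : 'M[R]_(d, r)) v :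
  measurable ([set c | rule c U = v] : set (borel_cV R d)).
Proof.
have := measurable_fun_pair1 (U : borel_mx R d r) (mrule (r := r)).
move=> /(_ measurableT [set v]); rewrite setTI; apply.
apply: closed_measurable_mx.
by apply/accessible_closed_set1/hausdorff_accessible; exact: norm_hausdorff.
Qed.

Section Run.
Context {n : nat}.
Implicit Types (c : 'I_n -> 'cV[R]_d) (i : 'I_n) (s : @state R d n).

Let state := @state R d n.
Let body := @loop_body R d X x0 rule n.
Let proc := @process R d X x0 rule n.
Definition mx_of s := projT2 s.1.

(** When the guard holds, the rule returns one of the finitely many extreme
points. *)
Lemma loop_body_finitely_valued i s :
  finitely_valued (fun x : borel_cV R d => body (fun=> x) i s : state).
Proof.
pose extend (v : 'cV[R]_d) : state :=
  (existT (fun r => 'M[R]_(d, r)) _ (row_mx (projT2 s.1) (v - x0)),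
   (i |: s.2)%SET).
have mA := measurable_uncovered (projT2 s.1).
have mr v (_ : extreme_points X v) := measurable_rule_fiber (projT2 s.1) v.
by apply: (finitely_valued_branch extend s mA finX _ mr) => x /vrule[].
Qed.

Lemma process_finitely_valued i s :
  finitely_valued (fun x : borel_cV R d => proc (fun=> x) i s : state).
Proof.
suff iter_fv k : finitely_valued
    (fun x : borel_cV R d => iter k (body (fun=> x) i) s) by exact: iter_fv.
elim: k => [|k IH]; first exact: finitely_valued_cst.
by have := finitely_valued_bind IH (loop_body_finitely_valued i).
Qed.

Lemma loop_body_range c i s :
  mx_range (mx_of s) `<=` mx_range (mx_of (body c i s)).
Proof.
rewrite /body /loop_body; case: asboolP => [_|_]; last exact: subset_refl.
move=> _ [z _ <-]; exists (col_mx z 0) => //.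
by rewrite /mx_of /= mul_row_col mulmx0 addr0.
Qed.

Lemma process_range c i s :
  mx_range (mx_of s) `<=` mx_range (mx_of (proc c i s)).
Proof.
suff iterP k : mx_range (mx_of s) `<=` mx_range (mx_of (iter k (body c i) s)).
  exact: iterP.
elim: k => [|k IH] //.
by apply: subset_trans IH _; exact: loop_body_range.
Qed.

Lemma process_covered c i s :
  ~ uncovered X x0 (c i) (mx_of s) -> proc c i s = s.
Proof.
move=> cov; suff iterE k : iter k (body c i) s = s by exact: iterE.
by elim: k => [|k IH] //; rewrite iterS IH /body /loop_body asboolF.
Qed.

Lemma process_uncovered_tags c i s : uncovered X x0 (c i) (mx_of s) ->
  (proc c i s).2 = (i |: s.2)%SET.
Proof.
(* The loop is unrolled [d] times, so it has to be excluded that [d = 0]. *)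
move=> unc; have d_gt0 : (0 < d)%N.
  have [_ _ /mxrank_append lt_rank] := vrule unc.
  exact: leq_trans (leq_ltn_trans (leq0n _) lt_rank) (rank_leq_row _).
have iterE k : (iter k.+1 (body c i) s).2 = (i |: s.2)%SET.
  elim: k => [|k IH]; first by rewrite /= /body /loop_body asboolT.
  rewrite iterS {1}/body /loop_body; case: asboolP => //= _.
  by rewrite IH finset.setUA finset.setUid.
by have := iterE d.-1; rewrite prednK.
Qed.

(** Each sample is covered when its loop exits, and stays so because ranges
grow. *)
Lemma learn_covered c (J : seq 'I_n) s i : i \in J ->
  ~ uncovered X x0 (c i) (mx_of (foldl (fun s i => proc c i s) s J)).
Proof.
have grow K t : mx_range (mx_of t) `<=`
    mx_range (mx_of (foldl (fun s i => proc c i s) t K)).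
  elim: K t => [|j K IH] t //=.
  by apply: subset_trans (IH _); exact: process_range.
elim: J s => [//|j J IH] s /=; rewrite inE => /predU1P[->|/IH]; last exact.
by move=> /(uncovered_anti (@grow _ _)); exact: process_exit.
Qed.

Definition sound (W : {vspace 'cV[R]_d}) s :=
  mx_range (mx_of s) `<=` [set` W] /\ (#|s.2| <= \rank (mx_of s))%N.

(** An appended column lies in [W] and is independent of the previous ones, so
the rank grows at least as fast as the set of triggering indices. *)
Lemma loop_body_sound (W : {vspace 'cV[R]_d}) c i s :
  (forall x, minimizers X (c i) x -> x - x0 \in W) ->
  sound W s -> sound W (body c i s).
Proof.
move=> minW [sW card_s]; rewrite /body /loop_body.
case: asboolP => [unc|//]; have [vmin _ nv] := vrule unc.
split; rewrite /mx_of /=.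
  move=> _ [z _ <-]; rewrite -[z]vsubmxK mul_row_col /= memvD //.
    by apply: sW; exists (usubmx z).
  by rewrite [dsubmx z]mx11_scalar mul_mx_scalar memvZ // minW.
apply: leq_trans (mxrank_append nv); rewrite cardsU1.
by rewrite (leq_trans (leq_add (leq_b1 _) card_s)).
Qed.

Lemma learn_sound (W : {vspace 'cV[R]_d}) c (J : seq 'I_n) s :
  (forall i x, minimizers X (c i) x -> x - x0 \in W) ->
  sound W s -> sound W (foldl (fun s i => proc c i s) s J).
Proof.
move=> minW; elim: J s => [//|i J IH] s sW /=; apply: IH.
suff iterW k : sound W (iter k (body c i) s) by exact: iterW.
by elim: k => [|k IHk] //; exact: loop_body_sound (minW i) IHk.
Qed.

End Run.
End Covering.

Lemma mxrank_le_dim {K : fieldType} d r (U : 'M[K]_(d, r))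
    (W : {vspace 'cV[K]_d}) :
  (forall j, col j U \in W) -> (\rank U <= \dim W)%N.
Proof.
move=> UW; pose B := \matrix_(i < d, k < \dim W) (vbasis W)`_k i 0.
pose D := \matrix_(k < \dim W, j < r) coord (vbasis W) k (col j U).
suff -> : U = B *m D by exact: mulmx_max_rank.
apply/matrixP => i j; rewrite mxE.
have /(congr1 (fun v : 'cV_d => v i 0)) := coord_vbasis (UW j).
rewrite mxE summxE => ->; apply: eq_bigr => k _.
by rewrite !mxE mulrC.
Qed.

(** * Guarantees for the learned matrix *)

(** The gap between the inequality that the supermartingale provides for the
risk [p] and the claimed bound, where [t] counts the appends and
[l = log (1 / delta)]. *)
Lemma risk_bound_weaken {R : realFieldType} (n : nat) (p t l : R) :
  (0 < n)%N -> 0 <= t -> 0 <= l -> n%:R * (p / 2) - t < l ->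
  p <= 4 / n%:R * (6 * t + (1 + l)).
Proof.
by move=> n_gt0 t_ge0 l_ge0 lt_p; rewrite mulrAC ler_pdivlMr ?ltr0n //; lra.
Qed.

Theorem theorem5 (R : realType) (d m n : nat)
    (A : 'M[R]_(m, d)) (b : 'cV[R]_m) (C : set 'cV[R]_d)
    (Pc : probability (borel_cV R d) R)
    (x0 : 'cV[R]_d) (rule : @tie_break_rule R d)
    (dO : measure_display) (Omega : measurableType dO) (P : probability Omega R)
    (c : 'I_n -> {RV P >-> borel_cV R d}) :
  let X := polytope A b in
  let Un w := learned_mx X x0 rule (fun i => c i w) in
  let Tn w := learned_idx X x0 rule (fun i => c i w) in
  let dstar := \dim (dir (all_minimizers X C)) in
  X !=set0 -> bounded_set X ->
  convex_set (C : set (convex_lmodType 'cV[R]_d)) ->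
  {ae Pc, forall x, C x} ->
  all_minimizers X C x0 ->
  valid_rule X x0 rule -> measurable_rule rule ->
  (0 < n)%N -> iid_from c Pc ->
  (forall w, (forall i, C (c i w)) ->
     [/\ mx_range (Un w) `<=` [set` dir (all_minimizers X C)],
         (#|Tn w| <= \rank (Un w) <= dstar)%N &
         forall i, Exact X (Un w) x0 (c i w)]) /\
  (forall w, measurable
     ([set x | Exact X (Un w) x0 x] : set (borel_cV R d))) /\
  (forall delta : R, 0 < delta < 1 ->
     let good := [set w |
       ((1 - 4 / n%:R * (6 * #|Tn w|%:R + ln (expR 1 / delta)))%:E
          <= Pc [set x | Exact X (Un w) x0 x])%E /\
       1 - 4 / n%:R * (6 * dstar%:R + ln (expR 1 / delta))
          <= 1 - 4 / n%:R * (6 * #|Tn w|%:R + ln (expR 1 / delta))] in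
     measurable good /\ ((1 - delta)%:E <= P good)%E).
Proof.
move=> X Un Tn dstar X0 bX _ aeC x0C vr mr n_gt0 iidc.
pose W := dir (all_minimizers X C).
pose st w : @state R d n := learn X x0 rule (fun i => c i w).
have finX : finite_set (extreme_points X) by exact: finite_extreme_points.
have ExactE r (U : 'M[R]_(d, r)) x : Exact X U x0 x <-> ~ uncovered X x0 x U.
  by apply: Exact_covered; exact: minimizers_nonempty.
have mExact r (U : 'M[R]_(d, r)) :
    measurable ([set x | Exact X U x0 x] : set (borel_cV R d)).
  rewrite (_ : [set _ | _] = ~` [set x | uncovered X x0 x U]).
    by apply: measurableC; exact: (measurable_uncovered vr finX).
  by apply/seteqP; split=> x /ExactE.
have soundW w : (forall i, C (c i w)) -> sound W (st w).
  move=> Cw; apply: (learn_sound vr).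
    move=> i x xmin; apply: (span_setP _).1; exists x; first by exists (c i w).
    by exists x0.
  split; last by rewrite /= cards0.
  by move=> _ [z _ <-]; rewrite /= mul0mx mem0v.
have rank_dstar w : (forall i, C (c i w)) -> (\rank (Un w) <= dstar)%N.
  move=> /soundW[UW _]; apply: mxrank_le_dim => j.
  by apply: UW; exists (delta_mx j 0) => //; rewrite colE.
split.
  move=> w Cw; have [UW TU] := soundW w Cw.
  split=> //; first by rewrite TU rank_dstar.
  by move=> i; apply/ExactE; apply: (learn_covered vr); rewrite ?mem_enum.
split; first by move=> w; exact: mExact.
move=> delta /andP[delta_gt0 delta_lt1] good.
pose step (i : 'I_n) x s := process X x0 rule (fun=> x) i s : @state R d n.
pose mistake (s : @state R d n) : set (borel_cV R d) :=
  [set x | uncovered X x0 x (mx_of s)].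
pose tags (s : @state R d n) := s.2.
have step_fv i s : finitely_valued (fun x : borel_cV R d => step i x s).
  exact: (process_finitely_valued vr finX mr).
have st_fv : finitely_valued st.
  exact: (run_finitely_valued c step_fv (@initial_state R d n) (enum 'I_n)).
have mgood : measurable good.
  pose Q (s : @state R d n) :=
    ((1 - 4 / n%:R * (6 * #|tags s|%:R + ln (expR 1 / delta)))%:E
          <= Pc [set x | Exact X (mx_of s) x0 x])%E /\
       1 - 4 / n%:R * (6 * dstar%:R + ln (expR 1 / delta))
          <= 1 - 4 / n%:R * (6 * #|tags s|%:R + ln (expR 1 / delta)).
  exact: (finitely_valued_preimage Q st_fv).
split=> //.
have mmist s : measurable (mistake s) by exact: (measurable_uncovered vr finX).
pose bad := overshoot Pc c step mistake tags (- ln delta)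
  (@initial_state R d n) (enum 'I_n).
have Pbad : (P bad <= delta%:E)%E.
  have -> : delta = expR (- (- ln delta)) by rewrite opprK lnK.
  apply: overshoot_probability => //.
  - by move=> i x s; exact: process_covered.
  - by move=> i x s; exact: (process_uncovered_tags vr).
  by move=> i x s y; apply: uncovered_anti; exact: process_range.
have mbad : measurable bad by exact: measurable_overshoot.
have [N [mN PN CN]] := aeC.
(* [C] is conull but possibly not Borel; [N] is a Borel null set containing its
   complement. *)
pose stray := \bigcup_i c i @^-1` N.
have mstray : measurable stray.
  by apply: fin_bigcup_measurable => // i _; exact: measurable_RV_preimage.
have Pstray : P stray = 0%E.
  apply: null_bigcup_RV => // i; have := iidc.2 i N mN.
  by rewrite PN.
have good_sub : ~` good `<=` bad `|` stray.
  apply: subsetCl => w; rewrite setCU => -[/= /negP nbad nstray].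
  have Cw i : C (c i w).
    by apply: contrapT => nC; apply: nstray; exists i => //; exact: CN.
  have [_ card_le] := soundW w Cw.
  have card_dstar : (#|Tn w| <= dstar)%N := leq_trans card_le (rank_dstar w Cw).
  have ln_le0 : ln delta <= 0 by rewrite ln_le0 // ltW.
  have lnE : ln (expR 1 / delta) = 1 - ln delta.
    by rewrite lnM ?posrE ?invr_gt0 ?expR_gt0 // expRK lnV ?posrE.
  split.
    have -> : [set x | Exact X (Un w) x0 x] = ~` mistake (st w).
      by apply/seteqP; split=> x /ExactE.
    rewrite probability_setC // -(fineK (fin_num_measure Pc _ (mmist (st w)))).
    rewrite -EFinB lee_fin lerD2l lerN2 lnE.
    apply: risk_bound_weaken; rewrite ?oppr_ge0 ?ler0n //.
    by rewrite ltNge; exact: nbad.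
  rewrite lerD2l lerN2 ler_wpM2l ?divr_ge0 ?ler0n // lerD2r ler_wpM2l ?ler0n //.
  by rewrite ler_nat.
have Pngood : (P (~` good) <= delta%:E)%E.
  apply: (@le_trans _ _ (P (bad `|` stray))); last by rewrite measureU0.
  by apply: le_measure; rewrite ?inE //;
    [exact: measurableC|exact: measurableU].
rewrite -[good]setCK probability_setC; last exact: measurableC.
by rewrite EFinB leeB.
Qed.
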